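(* Let $\sigma^2>0$, let $a,b,c$ be fixed real numbers, and let $\{\epsilon_{i,j},\ i,j\in\mathbb{Z}\}$ be a (given) collection of uncorrelated random variables with zero mean and equal variance $\sigma^2$. Put $$D=(1-a-b-c)(1-a+b+c)(1+a-b+c)(1+a+b-c).$$ A wide-sense stationary random field $X=\{X_{i,j},\ i,j\in\mathbb{Z}\}$ satisfying $$X_{i,j}=aX_{i-1,j}+bX_{i,j-1}+cX_{i-1,j-1}+\epsilon_{i,j}\qquad\text{for all } i,j\in\mathbb{Z}$$ exists if and only if $D>0$.
   Context: All random variables are real-valued. A random field $X=\{X_{i,j},\ i,j\in\mathbb{Z}\}$ is wide-sense stationary if all $X_{i,j}$ have finite second moment, $\mathsf{E}X_{i,j}$ does not depend on $(i,j)$, and $\operatorname{cov}(X_{i,j},X_{i-h_1,j-h_2})$ depends only on $(h_1,h_2)$. The field $X$ is defined on the same probability space as the given $\epsilon$. *)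

(* Defs.v *)
From mathcomp Require Import all_boot all_order all_algebra.
From mathcomp Require Import all_classical all_reals all_analysis.

Set Implicit Arguments.
Unset Strict Implicit.
Unset Printing Implicit Defensive.

Import Order.TTheory GRing.Theory Num.Theory.

Local Open Scope ring_scope.

(* Square integrability is required explicitly because the library's
   expectation, variance and covariance are total, with conventional values
   on non-integrable functions. *)

Definition white_noise (d : measure_display) (T : measurableType d)
    (R : realType) (P : probability T R) (sigma : R)
    (eps : int -> int -> {RV P >-> R}) : Prop :=
  [/\ forall i j, (eps i j : T -> R) \in Lfun P 2%:E,
      forall i j, ('E_P[eps i j] = 0)%E,
      forall i j, ('V_P[eps i j] = (sigma ^+ 2)%:E)%E &
      forall i j i' j', (i, j) != (i', j') ->
        covariance P (eps i j) (eps i' j') = 0%E].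

Definition wide_sense_stationary (d : measure_display) (T : measurableType d)
    (R : realType) (P : probability T R)
    (X : int -> int -> {RV P >-> R}) : Prop :=
  [/\ forall i j, (X i j : T -> R) \in Lfun P 2%:E,
      forall i j i' j', ('E_P[X i j] = 'E_P[X i' j'])%E &
      forall h1 h2 i j i' j',
        covariance P (X i j) (X (i - h1) (j - h2)) =
        covariance P (X i' j') (X (i' - h1) (j' - h2))].

(* Random variables are identified up to almost sure equality. *)
Definition ar_equation (d : measure_display) (T : measurableType d)
    (R : realType) (P : probability T R) (a b c : R)
    (eps X : int -> int -> {RV P >-> R}) : Prop :=
  forall i j : int,
    {ae P, forall w, X i j w = a * X (i - 1) j w + b * X i (j - 1) w
                             + c * X (i - 1) (j - 1) w + eps i j w}.

Arguments white_noise {d T R} P sigma eps.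
Arguments wide_sense_stationary {d T R} P X.
Arguments ar_equation {d T R} P a b c eps X.

(* Main.v *)
Require Import Defs.
From HB Require Import structures.
From mathcomp Require Import all_boot all_order all_algebra.
From mathcomp Require Import complex.
From mathcomp Require Import all_classical all_reals all_analysis.
From mathcomp Require Import measurable_realfun.
From mathcomp Require Import ring lra zify.

Import Order.TTheory GRing.Theory Num.Theory.
Import numFieldNormedType.Exports.
Local Open Scope ring_scope.

(* Put [g z w = 1 - a z - b w - c z w].  With [al = 1 + a^2 - b^2 - c^2] and
   [be = a + b c], one has [|1 - a z|^2 - |b + c z|^2 = al - 2 be Re z] on
   [|z| = 1], and [D = al^2 - 4 be^2]; hence [D > 0] iff [g] has no zero on the
   torus.

   If [D > 0], then [|g|] is bounded below on the torus, which for a stationary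
   field [F] reads [mu^2 E F^2 <= kappa E (G F)^2] with [G] the operator
   [F |-> F - a F(i-1,j) - b F(i,j-1) - c F(i-1,j-1)].  The gradient descent
   [X_(n+1) = X_n + kappa^-1 G^* (eps - G X_n)] therefore converges
   geometrically in [L^2], and almost surely, to a solution.

   If [D <= 0], a zero [(z, w)] of [g] gives the bounded field
   [h k l = Re (z^k w^l)], which [G^*] annihilates.  Multiply [h] by a
   logarithmic cutoff on the square [max(|k|, |l|) < N]: the result [v] has
   [v 0 0 = 1], while [sum (G^* v)^2] is of order [1 / log N], because points
   have zero capacity in dimension 2.  For a stationary solution [X], summation by parts
   gives [sigma^2 = E (X_00 * sum (G^* v)(k,l) eps_(-k,-l))], which contradicts
   the Cauchy-Schwarz inequality as [N] grows. *)

Set Implicit Arguments.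
Unset Strict Implicit.
Unset Printing Implicit Defensive.

Lemma eqW (disp : Order.disp_t) (T : porderType disp) (x y : T) :
  x = y -> (x <= y)%O.
Proof. by move=> ->. Qed.

(** * Semi-inner products *)

Section SemiInnerProduct.
Variables (R : realFieldType) (V : lmodType R) (B : V -> V -> R).
Hypothesis Bsym : forall u v, B u v = B v u.
Hypothesis Blin : forall k u v w, B (k *: u + v) w = k * B u w + B v w.
Hypothesis Bpos : forall u, 0 <= B u u.

Lemma sip0l w : B 0 w = 0.
Proof.
have := Blin 1 0 0 w; rewrite scaler0 addr0 mul1r => /eqP.
by rewrite -subr_eq0 opprD addNKr oppr_eq0 => /eqP.
Qed.

Lemma sipDl u v w : B (u + v) w = B u w + B v w.
Proof. by have := Blin 1 u v w; rewrite scale1r mul1r. Qed.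

Lemma sipZl k u w : B (k *: u) w = k * B u w.
Proof. by have := Blin k u 0 w; rewrite addr0 sip0l addr0. Qed.

Lemma sipNl u w : B (- u) w = - B u w.
Proof. by rewrite -scaleN1r sipZl mulN1r. Qed.

Lemma sipDr u v w : B w (u + v) = B w u + B w v.
Proof. by rewrite Bsym sipDl !(Bsym w). Qed.

Lemma sipZr k u w : B w (k *: u) = k * B w u.
Proof. by rewrite Bsym sipZl (Bsym w). Qed.

Lemma sipNr u w : B w (- u) = - B w u.
Proof. by rewrite Bsym sipNl (Bsym w). Qed.

Lemma sip_suml (I : finType) (F : I -> V) w :
  B (\sum_i F i) w = \sum_i B (F i) w.
Proof.
by apply: (big_morph (B^~ w)) => [u v|]; rewrite ?sipDl ?sip0l.
Qed.

Definition sipE := (sipDl, sipDr, sipZl, sipZr, sipNl, sipNr).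

(** [B] is only semidefinite, so a nonzero [v] may have [B v v = 0] and gets its own case; otherwise
    [s = B u v / B v v] minimises the quadratic [q]. *)
Lemma sip_CauchySchwarz u v : B u v ^+ 2 <= B u u * B v v.
Proof.
have q s : 0 <= B u u - 2 * s * B u v + s ^+ 2 * B v v.
  have := Bpos (u - s *: v); rewrite !sipE (Bsym v u).
  by move/le_trans; apply; apply: eqW; ring.
have [v0|v0] := eqVneq (B v v) 0.
  rewrite v0 mulr0.
  have [->|uv0] := eqVneq (B u v) 0; first by rewrite expr0n.
  (* For [B v v = 0] the bound [q] is affine in [s]; this [s] gives it the value -1. *)
  have := q ((B u u + 1) / (2 * B u v)); rewrite v0 mulr0 addr0.
  have -> : 2 * ((B u u + 1) / (2 * B u v)) * B u v = B u u + 1 by field.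
  lra.
have vp : 0 < B v v by rewrite lt0r v0 Bpos.
have := q (B u v / B v v).
have -> : B u u - 2 * (B u v / B v v) * B u v + (B u v / B v v) ^+ 2 * B v v =
  (B u u * B v v - B u v ^+ 2) / B v v by field.
by rewrite pmulr_lge0 ?invr_gt0// subr_ge0.
Qed.

Section Quadruple.
(** The vectors model a stationary field at [(i, j)], [(i - 1, j)], [(i, j - 1)], [(i - 1, j - 1)];
    the [g]'s are its inner products at lags (0,0), (1,0), (0,1), (1,1), (1,-1). *)
Variables (a b c : R) (x1 x2 x3 x4 : V) (g0 g10 g01 g11 g1N : R).
Hypotheses (e11 : B x1 x1 = g0) (e22 : B x2 x2 = g0) (e33 : B x3 x3 = g0)
  (e44 : B x4 x4 = g0) (e12 : B x1 x2 = g10) (e34 : B x3 x4 = g10)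
  (e13 : B x1 x3 = g01) (e24 : B x2 x4 = g01) (e14 : B x1 x4 = g11)
  (e23 : B x2 x3 = g1N).

Let e21 : B x2 x1 = g10. Proof. by rewrite Bsym. Qed.
Let e43 : B x4 x3 = g10. Proof. by rewrite Bsym. Qed.
Let e31 : B x3 x1 = g01. Proof. by rewrite Bsym. Qed.
Let e42 : B x4 x2 = g01. Proof. by rewrite Bsym. Qed.
Let e41 : B x4 x1 = g11. Proof. by rewrite Bsym. Qed.
Let e32 : B x3 x2 = g1N. Proof. by rewrite Bsym. Qed.
Let ee := (e11, e12, e13, e14, e21, e22, e23, e24, e31, e32, e33, e34,
  e41, e42, e43, e44).

(** This is [|al| - 2 |be|]. Since [D = al^2 - 4 be^2] is its product with [|al| + 2 |be|], [D > 0]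
    iff [mu > 0]. *)
Let mu := `|1 + a ^+ 2 - b ^+ 2 - c ^+ 2| - 2 * `|a + b * c|.

Lemma quad_norm :
  B (x1 - a *: x2 - b *: x3 - c *: x4) (x1 - a *: x2 - b *: x3 - c *: x4) =
    (1 + a ^+ 2 + b ^+ 2 + c ^+ 2) * g0 + 2 * (b * c - a) * g10 +
    2 * (a * c - b) * g01 + 2 * (a * b * g1N - c * g11).
Proof. by rewrite !sipE !ee; ring. Qed.

(** [4 sum |y_i|^2 - |sum y_i|^2] is the sum of [|y_i - y_j|^2] over [i < j]. Fixing only the
    squares of the coefficients covers every choice of signs. *)
Lemma quad_upper (s2 s3 s4 : R) :
  s2 ^+ 2 = a ^+ 2 -> s3 ^+ 2 = b ^+ 2 -> s4 ^+ 2 = c ^+ 2 ->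
  B (x1 + s2 *: x2 + s3 *: x3 + s4 *: x4) (x1 + s2 *: x2 + s3 *: x3 + s4 *: x4) <=
    4 * (1 + a ^+ 2 + b ^+ 2 + c ^+ 2) * g0.
Proof.
move=> E2 E3 E4.
have := Bpos (x1 - s2 *: x2); have := Bpos (x1 - s3 *: x3).
have := Bpos (x1 - s4 *: x4).
have := Bpos (s2 *: x2 - s3 *: x3); have := Bpos (s2 *: x2 - s4 *: x4).
have := Bpos (s3 *: x3 - s4 *: x4).
rewrite !sipE !ee -E2 -E3 -E4; nra.
Qed.

(* With [p = x1 - a x2] and [q = b x3 + c x4], [<p - q, p + q>] is
   [|p|^2 - |q|^2 = (1 + a^2 - b^2 - c^2) g0 - 2 (a + b c) g10]. *)
Lemma quad_lower :
  0 <= mu ->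
  mu ^+ 2 * g0 <= 4 * (1 + a ^+ 2 + b ^+ 2 + c ^+ 2) *
    B (x1 - a *: x2 - b *: x3 - c *: x4) (x1 - a *: x2 - b *: x3 - c *: x4).
Proof.
move=> mu0; set u := x1 - _ - _ - _.
pose w := x1 + (- a) *: x2 + b *: x3 + c *: x4.
have g0p : 0 <= g0 by rewrite -e11.
have hw : B w w <= 4 * (1 + a ^+ 2 + b ^+ 2 + c ^+ 2) * g0.
  by apply: quad_upper; rewrite ?sqrrN.
have huw : B u w = (1 + a ^+ 2 - b ^+ 2 - c ^+ 2) * g0 - 2 * (a + b * c) * g10.
  by rewrite /u /w !sipE !ee; ring.
have g10le : `|g10| <= g0.
  have := Bpos (x1 + x2); have := Bpos (x1 - x2);
  rewrite !sipE !ee ler_norml; lra.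
have h1 : mu * g0 <= `|B u w|.
  rewrite huw; apply: le_trans (lerB_dist _ _).
  rewrite !normrM (ger0_norm g0p) (@ger0_norm _ 2)// /mu.
  have := ler_wpM2l (normr_ge0 (a + b * c)) g10le; lra.
have h2 : (mu * g0) ^+ 2 <= B u u * (4 * (1 + a ^+ 2 + b ^+ 2 + c ^+ 2) * g0).
  apply: (@le_trans _ _ (`|B u w| ^+ 2)).
    by rewrite lerXn2r ?nnegrE// mulr_ge0.
  rewrite real_normK ?num_real//; apply: le_trans (sip_CauchySchwarz u w) _.
  by rewrite ler_wpM2l.
move: g0p; rewrite le_eqVlt => /predU1P[<-|g0p].
  by rewrite mulr0 !mulr_ge0//; have := Bpos u; nra.
rewrite -(ler_pM2r g0p); apply: le_trans (le_trans h2 _); apply: eqW; ring.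
Qed.

End Quadruple.
End SemiInnerProduct.

(** * Linear filters and gradient descent *)

Section Filters.
Variables (R : realFieldType) (V : lmodType R).
Implicit Types e F H : int -> int -> V.

Definition ar_op (a b c : R) F : int -> int -> V := fun i j =>
  F i j - a *: F (i - 1) j - b *: F i (j - 1) - c *: F (i - 1) (j - 1).

Definition ar_adj (a b c : R) F : int -> int -> V := fun i j =>
  F i j - a *: F (i + 1) j - b *: F i (j + 1) - c *: F (i + 1) (j + 1).

(** Induction over this closure carries stationarity and zero mean from [e] to all iterates of the
    descent. *)
Inductive filter_of e : (int -> int -> V) -> Prop :=
| filter_id : filter_of e e
| filter_lin k F H : filter_of e F -> filter_of e H ->
    filter_of e (fun i j => k *: F i j + H i j)
| filter_shift (s t : int) F : filter_of e F ->
    filter_of e (fun i j => F (i + s) (j + t)).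

Lemma filter_addZ e k F H : filter_of e F -> filter_of e H ->
  filter_of e (fun i j => H i j + k *: F i j).
Proof.
move=> fF fH; have := filter_lin k fF fH.
by congr filter_of; apply/funext => i; apply/funext => j; rewrite addrC.
Qed.

Lemma filter_subZ e k F H : filter_of e F -> filter_of e H ->
  filter_of e (fun i j => H i j - k *: F i j).
Proof.
move=> fF fH; have := filter_addZ (- k) fF fH.
by congr filter_of; apply/funext => i; apply/funext => j; rewrite scaleNr.
Qed.

Lemma filter_sub e F H : filter_of e F -> filter_of e H ->
  filter_of e (fun i j => H i j - F i j).
Proof.
move=> fF fH; have := filter_subZ 1 fF fH.
by congr filter_of; apply/funext => i; apply/funext => j; rewrite scale1r.
Qed.

Lemma filter_shift0l e t F :
  filter_of e F -> filter_of e (fun i j => F i (j + t)).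
Proof.
move=> /(filter_shift 0 t).
by congr filter_of; apply/funext => i; apply/funext => j; rewrite addr0.
Qed.

Lemma filter_shift0r e s F :
  filter_of e F -> filter_of e (fun i j => F (i + s) j).
Proof.
move=> /(filter_shift s 0).
by congr filter_of; apply/funext => i; apply/funext => j; rewrite addr0.
Qed.

Lemma filter_ar_op a b c e F : filter_of e F -> filter_of e (ar_op a b c F).
Proof.
move=> fF; apply: (filter_subZ c (F := fun i j => F (i - 1) (j - 1))).
  exact: filter_shift.
apply: (filter_subZ b (F := fun i j => F i (j - 1))); first exact: filter_shift0l.
by apply: (filter_subZ a (F := fun i j => F (i - 1) j)); first exact: filter_shift0r.
Qed.

Lemma filter_ar_adj a b c e F : filter_of e F -> filter_of e (ar_adj a b c F).
Proof.
move=> fF; apply: (filter_subZ c (F := fun i j => F (i + 1) (j + 1))).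
  exact: filter_shift.
apply: (filter_subZ b (F := fun i j => F i (j + 1))); first exact: filter_shift0l.
by apply: (filter_subZ a (F := fun i j => F (i + 1) j)); first exact: filter_shift0r.
Qed.

Lemma ar_opD a b c F H k i j :
  ar_op a b c (fun i j => F i j + k *: H i j) i j =
  ar_op a b c F i j + k *: ar_op a b c H i j.
Proof.
rewrite /ar_op !scalerBr !scalerDr !scalerA (mulrC k a) (mulrC k b) (mulrC k c).
do 3 rewrite opprD addrACA.
by rewrite (addrACA _ (k *: _ - _)) (addrACA _ (k *: _ - _ - _)).
Qed.

Fixpoint ar_descent (a b c tau : R) e n : int -> int -> V :=
  if n is n'.+1 then
    fun i j => ar_descent a b c tau e n' i j +
      tau *: ar_adj a b c
        (fun i j => e i j - ar_op a b c (ar_descent a b c tau e n') i j) i j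
  else fun _ _ => 0.

Definition ar_residual a b c tau e n : int -> int -> V :=
  fun i j => e i j - ar_op a b c (ar_descent a b c tau e n) i j.

Lemma filter_ar_descent a b c tau e n : filter_of e (ar_descent a b c tau e n).
Proof.
elim: n => [|n IH] /=.
  have := filter_sub (filter_id e) (filter_id e).
  by congr filter_of; apply/funext => i; apply/funext => j; rewrite subrr.
apply: filter_addZ => //; apply: filter_ar_adj; apply: filter_sub (filter_id e).
exact: filter_ar_op.
Qed.

Lemma filter_ar_residual a b c tau e n : filter_of e (ar_residual a b c tau e n).
Proof.
apply: filter_sub (filter_id e); exact/filter_ar_op/filter_ar_descent.
Qed.

(** [G] is linear, so the residual obeys a homogeneous recursion in which [e] survives only as the
    starting value. *)
Lemma ar_residualS a b c tau e n i j :
  ar_residual a b c tau e n.+1 i j = ar_residual a b c tau e n i j -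
    tau *: ar_op a b c (ar_adj a b c (ar_residual a b c tau e n)) i j.
Proof. by rewrite /ar_residual /= ar_opD opprD addrA. Qed.

Variable B : V -> V -> R.
Hypothesis Bsym : forall u v, B u v = B v u.
Hypothesis Blin : forall k u v w, B (k *: u + v) w = k * B u w + B v w.
Hypothesis Bpos : forall u, 0 <= B u u.

Let sipE := (sipDl Blin, sipDr Bsym Blin, sipZl Blin, sipZr Bsym Blin,
  sipNl Blin, sipNr Bsym Blin).

Variables (a b c : R) (e : int -> int -> V).
Hypothesis e_stat : forall s t i j k l : int,
  B (e (i + s) (j + t)) (e (k + s) (l + t)) = B (e i j) (e k l).

(** Bilinearity handles linear combinations. [H] stays general in the induction on [F], because a
    shift of [F] is traded for a change of [H]. *)
Lemma filter_stat F H :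
  filter_of e F -> filter_of e H -> forall s t i j k l : int,
  B (F (i + s) (j + t)) (H (k + s) (l + t)) = B (F i j) (H k l).
Proof.
move=> fF; elim: fF H => [H|x F1 F2 _ IH1 _ IH2 H|s' t' F1 _ IH H] fH s t i j k l.
- elim: fH s t i j k l => [//|x F1 F2 _ IH1 _ IH2|s' t' F1 _ IH] s t i j k l.
    by rewrite !sipE IH1 IH2.
  by rewrite (addrAC k) (addrAC l) IH.
- by rewrite !sipE IH1 // IH2.
- pose H' (i j : int) := H (i - s') (j - t').
  have fH' : filter_of e H' by exact: filter_shift.
  have HE x y : H x y = H' (x + s') (y + t') by rewrite /H' !addrK.
  rewrite !HE (addrAC i) (addrAC j) (addrAC k) (addrAC l).
  exact: (IH H' fH').
Qed.

Lemma filter_statP F H i j k l i' j' k' l' : filter_of e F -> filter_of e H ->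
  i - k = i' - k' -> j - l = j' - l' -> B (F i j) (H k l) = B (F i' j') (H k' l').
Proof.
move=> fF fH E1 E2; rewrite -(filter_stat fF fH (i - i') (j - j') i' j' k' l').
by congr (B (F _ _) (H _ _)); lia.
Qed.

Let kappa := 4 * (1 + a ^+ 2 + b ^+ 2 + c ^+ 2).
Let mu := `|1 + a ^+ 2 - b ^+ 2 - c ^+ 2| - 2 * `|a + b * c|.

(** Adjointness holds at a single site, without summation: by stationarity a shift of [H] can be
    replaced by the opposite shift of [F]. *)
Lemma ar_adjP F H i j : filter_of e F -> filter_of e H ->
  B (F i j) (ar_op a b c H i j) = B (ar_adj a b c F i j) (H i j).
Proof.
move=> fF fH; rewrite /ar_op /ar_adj !sipE.
by congr (_ + - (_ * _) + - (_ * _) + - (_ * _)); apply: filter_statP => //; lia.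
Qed.

Lemma ar_op_upper F i j : filter_of e F ->
  B (ar_op a b c F i j) (ar_op a b c F i j) <= kappa * B (F i j) (F i j).
Proof.
move=> fF; rewrite /ar_op -!scaleNr.
apply: (quad_upper Bsym Blin Bpos (g10 := B (F i j) (F (i - 1) j))
  (g01 := B (F i j) (F i (j - 1)))
  (g11 := B (F i j) (F (i - 1) (j - 1)))
  (g1N := B (F (i - 1) j) (F i (j - 1))));
  by rewrite ?sqrrN //; apply: filter_statP => //; lia.
Qed.

Lemma ar_op_lower F i j : filter_of e F -> 0 <= mu ->
  mu ^+ 2 * B (F i j) (F i j) <= kappa * B (ar_op a b c F i j) (ar_op a b c F i j).
Proof.
move=> fF mu0; rewrite /ar_op.
apply: (quad_lower Bsym Blin Bpos (g10 := B (F i j) (F (i - 1) j))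
  (g01 := B (F i j) (F i (j - 1)))
  (g11 := B (F i j) (F (i - 1) (j - 1)))
  (g1N := B (F (i - 1) j) (F i (j - 1)))) => //;
  by apply: filter_statP => //; lia.
Qed.

(** [quad_norm] involves only inner products at given lags; [ar_adj] reverses every lag, which
    changes nothing because [B] is symmetric. *)
Lemma ar_adj_norm F i j : filter_of e F ->
  B (ar_adj a b c F i j) (ar_adj a b c F i j) =
  B (ar_op a b c F i j) (ar_op a b c F i j).
Proof.
move=> fF; rewrite /ar_op /ar_adj.
transitivity ((1 + a ^+ 2 + b ^+ 2 + c ^+ 2) * B (F i j) (F i j) +
  2 * (b * c - a) * B (F i j) (F (i - 1) j) +
  2 * (a * c - b) * B (F i j) (F i (j - 1)) +
  2 * (a * b * B (F (i - 1) j) (F i (j - 1)) -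
    c * B (F i j) (F (i - 1) (j - 1)))).
  apply: (quad_norm Bsym Blin) => //;
    by [apply: filter_statP => //; lia | rewrite Bsym; apply: filter_statP => //; lia].
by apply/esym/(quad_norm Bsym Blin) => //; apply: filter_statP => //; lia.
Qed.

Let kappa_gt0 : 0 < kappa. Proof. rewrite /kappa; nra. Qed.

(* [<F, G G^* F> = |G^* F|^2 = |G F|^2], where [G = ar_op] and [G^* = ar_adj]. *)
Lemma ar_residual_decay F i j : filter_of e F -> 0 <= mu ->
  B (F i j - kappa^-1 *: ar_op a b c (ar_adj a b c F) i j)
    (F i j - kappa^-1 *: ar_op a b c (ar_adj a b c F) i j) <=
  (1 - mu ^+ 2 / kappa ^+ 2) * B (F i j) (F i j).
Proof.
move=> fF mu0.
have fA := filter_ar_adj a b c fF.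
have hA := ar_adjP i j fF fA.
have h2 := ar_op_upper i j fA.
have := ar_op_lower i j fF mu0; rewrite -ar_adj_norm// => h1.
move: hA h1 h2.
move: (ar_op a b c (ar_adj a b c F) i j) (ar_adj a b c F i j)
  (F i j) => G A u hA h1 h2.
rewrite !sipE (Bsym G) hA.
(* With step [kappa^-1] the quadratic term is at most half the cross term, which leaves the upper
   bound [|F|^2 - |G^* F|^2 / kappa]. *)
have h3 : kappa^-1 * (kappa^-1 * B G G) <= kappa^-1 * B A A.
  by rewrite ler_pM2l ?invr_gt0// ler_pdivrMl.
have h4 : mu ^+ 2 / kappa ^+ 2 * B u u <= kappa^-1 * B A A.
  have -> : kappa^-1 * B A A = kappa * B A A / kappa ^+ 2.
    by field; rewrite gt_eqF.
  by rewrite mulrAC ler_pM2r// invr_gt0 exprn_gt0.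
lra.
Qed.

Lemma mu_le_kappa : mu <= kappa.
Proof.
rewrite /mu /kappa.
have : `|1 + a ^+ 2 - b ^+ 2 - c ^+ 2| <= 1 + a ^+ 2 + b ^+ 2 + c ^+ 2.
  by rewrite ler_norml; apply/andP; split; nra.
have := normr_ge0 (a + b * c); nra.
Qed.

Lemma decay_rate : 0 < mu -> 0 <= 1 - mu ^+ 2 / kappa ^+ 2 < 1.
Proof.
move=> mu0; rewrite gtrBl subr_ge0 ler_pdivrMr ?exprn_gt0// mul1r.
by rewrite lerXn2r ?nnegrE ?mu_le_kappa ?(ltW mu0) ?ltW ?divr_gt0 ?exprn_gt0.
Qed.

Lemma ar_residual_le n i j : 0 < mu ->
  B (ar_residual a b c kappa^-1 e n i j) (ar_residual a b c kappa^-1 e n i j) <=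
  (1 - mu ^+ 2 / kappa ^+ 2) ^+ n * B (e i j) (e i j).
Proof.
move=> mu0; have /andP[q0 _] := decay_rate mu0.
elim: n => [|n IH].
  by rewrite expr0 mul1r /ar_residual /= /ar_op !scaler0 !subr0.
rewrite ar_residualS exprS -mulrA.
apply: le_trans (ar_residual_decay _ _ (filter_ar_residual _ _ _ _ _ _) (ltW mu0)) _.
by rewrite ler_wpM2l.
Qed.

(** The increment is [kappa^-1 G^* r_n], and [|G^* r_n|^2 <= kappa |r_n|^2]. *)
Lemma ar_descent_step_le n i j : 0 < mu ->
  B (ar_descent a b c kappa^-1 e n.+1 i j - ar_descent a b c kappa^-1 e n i j)
    (ar_descent a b c kappa^-1 e n.+1 i j - ar_descent a b c kappa^-1 e n i j) <=
  kappa^-1 * B (e i j) (e i j) * (1 - mu ^+ 2 / kappa ^+ 2) ^+ n.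
Proof.
move=> mu0; rewrite /= addrC addKr -/(ar_residual a b c kappa^-1 e n).
have fr := filter_ar_residual a b c kappa^-1 e n.
rewrite (sipZl Blin) (sipZr Bsym Blin) -mulrA (ler_pM2l) ?invr_gt0// ler_pdivrMl//.
rewrite ar_adj_norm//; apply: le_trans (ar_op_upper _ _ fr) _.
by rewrite ler_pM2l// mulrC ar_residual_le.
Qed.

End Filters.

(** * Zeros on the torus and slowly varying truncations *)

Section Torus.
Variables (R : rcfType) (a b c : R).
Local Open Scope complex_scope.

(** For [z] on the circle, [w] can be solved for on the circle when [|1 - a z| = |b + c z|], that is
    when [al = 2 be Re z]; [D <= 0] allows such a real part in [[-1, 1]]. *)
Lemma torus_zero :
  (1 - a - b - c) * (1 - a + b + c) * (1 + a - b + c) * (1 + a + b - c) <= 0 ->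
  exists z w : R[i], [/\ `|z| = 1, `|w| = 1 &
    1 = a%:C * z + b%:C * w + c%:C * (z * w)].
Proof.
set al := 1 + a ^+ 2 - b ^+ 2 - c ^+ 2; set be := a + b * c => hD.
have hx : exists x, -1 <= x <= 1 /\ al = 2 * be * x.
  have h : al ^+ 2 <= (2 * be) ^+ 2.
    by rewrite -subr_le0; apply: le_trans hD; apply: eqW; rewrite /al /be; ring.
  have [b0|b0] := eqVneq be 0.
    exists 0; split; first by rewrite lerN10 ler01.
    move: h; rewrite b0 mulr0 expr0n mulr0 /= => h.
    by apply/eqP; rewrite -sqrf_eq0 eq_le h sqr_ge0.
  exists (al / (2 * be)); split; last by field.
  have b20 : 2 * be != 0 by rewrite mulf_neq0 ?pnatr_eq0.
  rewrite -ler_norml normrM normfV ler_pdivrMr ?normr_gt0// mul1r.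
  by rewrite -(@ler_pXn2r _ 2) ?nnegrE// !real_normK ?num_real.
have [x [/andP[x1 x2] hax]] := hx.
pose y := Num.sqrt (1 - x ^+ 2).
have hy : y ^+ 2 = 1 - x ^+ 2 by rewrite sqr_sqrtr// subr_ge0; nra.
pose z : R[i] := x +i* y.
have z1 : `|z| = 1 by rewrite normc_def /= hy addrC subrK sqrtr1.
have nN : `|1 - a%:C * z| = `|b%:C + c%:C * z|.
  rewrite !normc_def /=; congr (Num.sqrt _)%:C.
  rewrite !mul0r !subr0 !addr0 !add0r.
  have ha := congr1 ( *%R (a ^+ 2)) hy; have hc := congr1 ( *%R (c ^+ 2)) hy.
  move: hax ha hc; rewrite /al /be; lra.
have [q0|q0] := eqVneq (b%:C + c%:C * z) 0.
  (* Here [1 - a z] vanishes as well, so any [w] on the circle works. *)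
  exists z, 1; split; rewrite ?normr1//.
  have : 1 - a%:C * z = 0 by apply/eqP; rewrite -normr_eq0 nN q0 normr0.
  move/eqP; rewrite subr_eq0 => /eqP {1}->.
  by rewrite !mulr1 -addrA q0 addr0.
exists z, ((1 - a%:C * z) / (b%:C + c%:C * z)); split => //.
  by rewrite normf_div nN divff// normr_eq0.
by field.
Qed.

(** [z^k w^l] has modulus 1, and multiplying [g z w = 0] by it gives the recursion; real
    coefficients let the real part through. *)
Lemma bounded_harmonic :
  (1 - a - b - c) * (1 - a + b + c) * (1 + a - b + c) * (1 + a + b - c) <= 0 ->
  exists h : int -> int -> R, [/\ h 0 0 = 1, forall k l, `|h k l| <= 1 &
    forall k l, h k l =
      a * h (k + 1) l + b * h k (l + 1) + c * h (k + 1) (l + 1)].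
Proof.
move=> /torus_zero[z [w [z1 w1 hzw]]].
have z0 : z != 0 by rewrite -normr_eq0 z1 oner_eq0.
have w0 : w != 0 by rewrite -normr_eq0 w1 oner_eq0.
have ReM (k : R) (u : R[i]) : complex.Re (k%:C * u) = k * complex.Re u.
  by case: u => u v /=; rewrite mul0r subr0.
have normXz (u : R[i]) (n : int) : `|u| = 1 -> `|u ^ n| = 1.
  move=> u1; case: n => n;
    by rewrite ?NegzE -?exprnP -?exprnN ?normfV normrX u1 expr1n ?invr1.
exists (fun k l => complex.Re (z ^ k * w ^ l)); split => [|k l|k l].
- by rewrite !expr0z mulr1.
- rewrite -lecR; apply: le_trans (normc_ge_Re _) _.
  by rewrite normrM !normXz// mulr1.
- rewrite !expfzDr// !expr1z -!ReM -!raddfD /=; congr (complex.Re _).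
  by rewrite -[LHS]mulr1 {1}hzw; ring.
Qed.
End Torus.

(** * Sums over boxes and summation by parts *)

Section BoxSums.
Variable R : realFieldType.
Implicit Types f g : int -> R.

(* The sum of [f k] over [- N <= k <= N]. *)
Definition sym_sum (N : nat) f : R := \sum_(p < (2 * N).+1) f (p%:Z - N%:Z).

Lemma eq_sym_sum N f g : (forall k, f k = g k) -> sym_sum N f = sym_sum N g.
Proof. by move=> fg; apply: eq_bigr => p _; rewrite fg. Qed.

Lemma sym_sumD N f g :
  sym_sum N (fun k => f k + g k) = sym_sum N f + sym_sum N g.
Proof. exact: big_split. Qed.

Lemma sym_sumN N f : sym_sum N (fun k => - f k) = - sym_sum N f.
Proof. exact: sumrN. Qed.

Lemma sym_sumZ N (x : R) f : sym_sum N (fun k => x * f k) = x * sym_sum N f.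
Proof. by rewrite /sym_sum mulr_sumr. Qed.

Lemma ler_sym_sum N f g : (forall k, f k <= g k) -> sym_sum N f <= sym_sum N g.
Proof. by move=> fg; apply: ler_sum. Qed.

Lemma sym_sum0 N f : (forall k, f k = 0) -> sym_sum N f = 0.
Proof. by move=> f0; apply: big1. Qed.

(** The shifted sum gains the term at [N + 1] and loses the one at [- N]; both vanish. *)
Lemma sym_sum_shift N f : f (N%:Z + 1) = 0 -> f (- N%:Z) = 0 ->
  sym_sum N (fun k => f (k + 1)) = sym_sum N f.
Proof.
move=> f1 f0; rewrite /sym_sum big_ord_recr [RHS]big_ord_recl /=.
rewrite (_ : _ - _ + 1 = N%:Z + 1); last by lia.
rewrite f1 add0r f0 add0r addr0; apply: eq_bigr => p _; congr f.
by rewrite /bump /=; lia.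
Qed.

Lemma exchange_sym_sum N (f : int -> int -> R) :
  sym_sum N (fun k => sym_sum N (f k)) = sym_sum N (fun l => sym_sum N (f^~ l)).
Proof. exact: exchange_big. Qed.

Lemma sym_sum_abs_le N (F : nat -> R) : (forall n, 0 <= F n) ->
  sym_sum N (fun k => F `|k|%N) <= 2 * \sum_(0 <= p < N.+1) F p.
Proof.
move=> F0; rewrite /sym_sum -(big_mkord xpredT (fun p : nat => F `|p%:Z - N%:Z|%N)).
rewrite (big_cat_nat (n := N)) //=; last by lia.
have -> : \sum_(N <= p < (2 * N).+1) F `|p%:Z - N%:Z|%N = \sum_(0 <= p < N.+1) F p.
  rewrite -{1}[N]add0n big_addn; rewrite (_ : (2 * N).+1 - N = N.+1)%N; last by lia.
  by apply: eq_bigr => p _; congr F; lia.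
rewrite mulrDl !mul1r lerD2r.
rewrite big_nat_rev /= [leRHS]big_nat_recl//= ler_wpDl//.
by apply: ler_sum_nat => p /andP[_ pN]; apply: eqW; congr F; lia.
Qed.

Section SummationByParts.
Variables (N : nat) (v psi : int -> int -> R) (a b c : R).
Hypothesis v0 : forall k l, (N <= maxn `|k| `|l|)%N -> v k l = 0.

Let sbp1 l : sym_sum N (fun k => v k l * psi (k - 1) l) =
  sym_sum N (fun k => v (k + 1) l * psi k l).
Proof.
rewrite -(@sym_sum_shift N (fun k => v k l * psi (k - 1) l)).
- by apply: eq_sym_sum => k; rewrite addrK.
- by rewrite v0 ?mul0r//; lia.
- by rewrite v0 ?mul0r//; lia.
Qed.

Let sbp2 k : sym_sum N (fun l => v k l * psi k (l - 1)) =
  sym_sum N (fun l => v k (l + 1) * psi k l).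
Proof.
rewrite -(@sym_sum_shift N (fun l => v k l * psi k (l - 1))).
- by apply: eq_sym_sum => l; rewrite addrK.
- by rewrite v0 ?mul0r//; lia.
- by rewrite v0 ?mul0r//; lia.
Qed.

Let sbp3 : sym_sum N (fun k => sym_sum N (fun l => v k l * psi (k - 1) (l - 1))) =
  sym_sum N (fun k => sym_sum N (fun l => v (k + 1) (l + 1) * psi k l)).
Proof.
rewrite -(@sym_sum_shift N
  (fun k => sym_sum N (fun l => v k l * psi (k - 1) (l - 1)))).
- apply: eq_sym_sum => k.
  rewrite -(@sym_sum_shift N (fun l => v (k + 1) l * psi (k + 1 - 1) (l - 1))).
  + by apply: eq_sym_sum => l; rewrite !addrK.
  + by rewrite v0 ?mul0r//; lia.
  + by rewrite v0 ?mul0r//; lia.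
- by apply: sym_sum0 => l; rewrite v0 ?mul0r//; lia.
- by apply: sym_sum0 => l; rewrite v0 ?mul0r//; lia.
Qed.

(** [v] is zero on the outermost layer of the box and beyond, so shifting an index leaves no
    boundary term, and the operator acting on [psi] passes to [v] as its adjoint. *)
Lemma summation_by_parts :
  sym_sum N (fun k => sym_sum N (fun l => v k l *
    (psi k l - a * psi (k - 1) l - b * psi k (l - 1) - c * psi (k - 1) (l - 1)))) =
  sym_sum N (fun k => sym_sum N (fun l =>
    (v k l - a * v (k + 1) l - b * v k (l + 1) - c * v (k + 1) (l + 1)) * psi k l)).
Proof.
transitivity (sym_sum N (fun k => sym_sum N (fun l => v k l * psi k l))
  - a * sym_sum N (fun k => sym_sum N (fun l => v k l * psi (k - 1) l))
  - b * sym_sum N (fun k => sym_sum N (fun l => v k l * psi k (l - 1)))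
  - c * sym_sum N (fun k => sym_sum N (fun l => v k l * psi (k - 1) (l - 1)))).
  rewrite -!sym_sumZ -!sym_sumN -!sym_sumD; apply: eq_sym_sum => k.
  rewrite -!sym_sumZ -!sym_sumN -!sym_sumD; apply: eq_sym_sum => l; ring.
rewrite sbp3 [X in _ - a * X]exchange_sym_sum.
rewrite (eq_sym_sum N sbp1) (eq_sym_sum N sbp2) [X in _ - a * X]exchange_sym_sum.
rewrite -!sym_sumZ -!sym_sumN -!sym_sumD; apply: eq_sym_sum => k.
rewrite -!sym_sumZ -!sym_sumN -!sym_sumD; apply: eq_sym_sum => l; ring.
Qed.

End SummationByParts.
End BoxSums.

(** * The logarithmic cutoff *)

Section Cutoff.
Variable R : realType.
Local Notation hs N := (series (@harmonic R) N).

Lemma series_harmonic_unbounded (M : R) : exists N, M <= hs N.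
Proof.
apply: contrapT => /forallNP hM; apply: (@dvg_harmonic R).
apply: nondecreasing_is_cvgn.
  by apply: nondecreasing_series => n _ _; exact: harmonic_ge0.
exists M => _ [n _ <-]; apply/ltW; rewrite ltNge; exact/negP/hM.
Qed.

Lemma series_harmonic_gt0 N : (0 < N)%N -> 0 < hs N.
Proof.
case: N => // N _; rewrite /series /= big_nat_recl//= ltr_wpDr ?harmonic_gt0//.
by apply: sumr_ge0 => i _; exact: (@harmonic_ge0 R i.+1).
Qed.

(** As [harmonic m = 1 / (m + 1)], for [N > 0] this is [1 - H_r / H_N] when [r <= N] and 0 beyond,
    with [H_n] the harmonic numbers; roughly [1 - log r / log N]. *)
Definition log_cutoff N r : R := (\sum_(r <= m < N) harmonic m) / hs N.

Lemma log_cutoff0 N : (0 < N)%N -> log_cutoff N 0 = 1.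
Proof.
by move=> N0; rewrite /log_cutoff divff// gt_eqF// series_harmonic_gt0.
Qed.

Lemma log_cutoff_out N r : (N <= r)%N -> log_cutoff N r = 0.
Proof. by move=> Nr; rewrite /log_cutoff big_geq// mul0r. Qed.

Lemma log_cutoffS N r : (0 < N)%N ->
  `|log_cutoff N r - log_cutoff N r.+1| <= harmonic r / hs N.
Proof.
move=> N0; have hp := series_harmonic_gt0 N0.
have [Nr|rN] := leqP N r.
  rewrite !log_cutoff_out//; last by lia.
  by rewrite subrr normr0 divr_ge0 ?harmonic_ge0// ltW.
rewrite /log_cutoff -mulrBl (big_ltn rN) addrK ger0_norm//.
by rewrite divr_ge0 ?harmonic_ge0// ltW.
Qed.

(** The factor 2 serves the inner neighbour [r' = r - 1]: [1 / r <= 2 / (r + 1)]. *)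
Lemma log_cutoff_lipschitz N r r' :
  (0 < N)%N -> (r' <= r.+1)%N -> (r <= r'.+1)%N ->
  `|log_cutoff N r - log_cutoff N r'| <= 2 * harmonic r / hs N.
Proof.
move=> N0 h1 h2; have hp := series_harmonic_gt0 N0.
have hr := @harmonic_ge0 R r.
have [->|[->|->]] : r' = r \/ r' = r.+1 \/ r = r'.+1 by lia.
- by rewrite subrr normr0 divr_ge0 ?mulr_ge0// ltW.
- apply: le_trans (log_cutoffS _ N0) _.
  by rewrite ler_pM2r ?invr_gt0// ler_peMl// ler1n.
- rewrite distrC; apply: le_trans (log_cutoffS _ N0) _.
  rewrite ler_pM2r ?invr_gt0//= ler_pdivlMr ?ltr0Sn// mulrC ler_pdivrMr ?ltr0Sn//.
  by rewrite -natrM ler_nat; lia.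
Qed.

(** By symmetry it is enough, at the cost of a factor 2, to sum over [|l| <= |k|]. There are at most
    [2 (|k| + 1)] such [l], so row [k] contributes at most [2 / (|k| + 1)]; the two signs of [k]
    give the last factor 2. *)
Lemma box_sum_bound N :
  sym_sum N (fun k => sym_sum N (fun l => harmonic (maxn `|k| `|l|) ^+ 2)) <=
  8 * hs N.+1 :> R.
Proof.
pose f (k l : int) : R := (`|l| <= `|k|)%N%:R * harmonic `|k|%N ^+ 2.
have hf k l : harmonic (maxn `|k| `|l|) ^+ 2 <= f k l + f l k.
  rewrite /f; have [kl|kl] := leqP `|l|%N `|k|%N.
    by rewrite mul1r ler_wpDr// mulr_ge0 ?sqr_ge0.
  by rewrite mul0r add0r (ltnW kl) mul1r.
apply: (@le_trans _ _ (sym_sum N (fun k => sym_sum N (fun l => f k l + f l k)))).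
  by apply: ler_sym_sum => k; apply: ler_sym_sum => l; exact: hf.
rewrite (eq_sym_sum N (fun k => sym_sumD N (f k) (f^~ k))) sym_sumD.
rewrite -(exchange_sym_sum N f).
rewrite -mulr2n -[X in X <= _]mulr_natl.
rewrite (_ : 8 * hs N.+1 = 2 * (2 * (2 * hs N.+1))); last by ring.
rewrite ler_pM2l//.
have hk k : sym_sum N (f k) <= 2 * harmonic `|k|%N.
  rewrite /f -(eq_sym_sum N (fun l => mulrC _ _)) sym_sumZ.
  apply: (@le_trans _ _ (harmonic `|k|%N ^+ 2 * (2 * `|k|.+1%:R))).
    rewrite ler_wpM2l ?sqr_ge0//.
    apply: le_trans (@sym_sum_abs_le R N (fun n => (n <= `|k|)%N%:R) _) _ => //.
    rewrite ler_pM2l// -natr_sum ler_nat.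
    suff -> : (\sum_(0 <= i < N.+1) (i <= `|k|) = minn N.+1 `|k|.+1)%N.
      by rewrite geq_minr.
    elim: N.+1 => [|n IH]; first by rewrite big_nil min0n.
    by rewrite big_nat_recr//= IH; lia.
  have y0 : `|k|.+1%:R != 0 :> R by rewrite pnatr_eq0.
  rewrite /=; move: (`|k|.+1%:R) y0 => y y0.
  by apply: eqW; field.
apply: (@le_trans _ _ (sym_sum N (fun k => 2 * harmonic `|k|%N))).
  by apply: ler_sym_sum.
rewrite sym_sumZ ler_pM2l//; apply: sym_sum_abs_le => n; exact: harmonic_ge0.
Qed.

(** [G^*] annihilates [h], so [G^* v] only sees differences of the cutoff between neighbours, at
    most [2 / ((m + 1) H_N)] at radius [m]. By [box_sum_bound] the squares sum to order
    [1 / H_N]. *)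
Lemma slowly_varying_truncation (h : int -> int -> R) (a b c e : R) :
  h 0 0 = 1 -> (forall k l, `|h k l| <= 1) ->
  (forall k l, h k l = a * h (k + 1) l + b * h k (l + 1) + c * h (k + 1) (l + 1)) ->
  0 < e -> exists N (v : int -> int -> R), [/\ v 0 0 = 1,
    forall k l, (N <= maxn `|k| `|l|)%N -> v k l = 0 &
    sym_sum N (fun k => sym_sum N (fun l => (v k l - a * v (k + 1) l - b * v k (l + 1)
      - c * v (k + 1) (l + 1)) ^+ 2)) <= e].
Proof.
move=> h00 h1 hE e0; pose K := `|a| + `|b| + `|c|.
(* [64 = 4 * 8 * 2]: the squared Lipschitz factor, the box sum, and [H_(N+1) <= 2 H_N]. The last
   uses [H_N >= 1], which also forces [N > 0]. *)
have [N hN] := series_harmonic_unbounded (Num.max 1 (64 * K ^+ 2 / e)).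
have N0 : (0 < N)%N.
  case: N hN => //; rewrite /series /= big_nil ge_max ler10; lra.
have hp := series_harmonic_gt0 N0.
move: hN; rewrite ge_max => /andP[hN1 hN].
pose chi k l := log_cutoff N (maxn `|k| `|l|).
exists N, (fun k l => h k l * chi k l); split.
- by rewrite /chi /= h00 mul1r log_cutoff0.
- by move=> k l kl; rewrite /chi log_cutoff_out// mulr0.
have pt k l : (h k l * chi k l - a * (h (k + 1) l * chi (k + 1) l)
    - b * (h k (l + 1) * chi k (l + 1))
    - c * (h (k + 1) (l + 1) * chi (k + 1) (l + 1))) ^+ 2 <=
    4 * K ^+ 2 / hs N ^+ 2 * harmonic (maxn `|k| `|l|) ^+ 2.
  set m := maxn `|k| `|l|; set dl : R := 2 * harmonic m / hs N.
  have dif k' l' : (maxn `|k'| `|l'| <= m.+1)%N -> (m <= (maxn `|k'| `|l'|).+1)%N ->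
      `|h k' l' * (chi k l - chi k' l')| <= dl.
    move=> A1 A2; rewrite normrM -[dl]mul1r ler_pM// log_cutoff_lipschitz//.
  rewrite (_ : 4 * K ^+ 2 / hs N ^+ 2 * harmonic m ^+ 2 = (K * dl) ^+ 2); last first.
    by rewrite /dl; move: (harmonic m) => y; field; rewrite gt_eqF.
  (* Expanding [h k l] by its recursion pairs each shifted [h] with a difference of cutoffs. *)
  rewrite {1}hE.
  rewrite (_ : _ - _ = a * (h (k + 1) l * (chi k l - chi (k + 1) l)) +
    b * (h k (l + 1) * (chi k l - chi k (l + 1))) +
    c * (h (k + 1) (l + 1) * (chi k l - chi (k + 1) (l + 1)))); last by ring.
  rewrite -real_normK ?num_real// lerXn2r ?nnegrE//.
    by rewrite mulr_ge0 ?addr_ge0// divr_ge0 ?mulr_ge0 ?harmonic_ge0// ltW.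
  rewrite /K 2!mulrDl.
  by apply: le_trans (ler_normD _ _) _; apply: lerD;
    [apply: le_trans (ler_normD _ _) _; apply: lerD|];
    rewrite normrM ler_wpM2l// dif//; lia.
apply: le_trans (ler_sym_sum _ _) _.
  by move=> k; apply: ler_sym_sum => l; exact: pt.
under eq_sym_sum do rewrite sym_sumZ.
rewrite sym_sumZ; apply: (@le_trans _ _ (4 * K ^+ 2 / hs N ^+ 2 * (8 * (2 * hs N)))).
  have K0 : 0 <= K by rewrite !addr_ge0.
  rewrite ler_wpM2l ?divr_ge0 ?mulr_ge0 ?(ltW hp)//.
  apply: le_trans (box_sum_bound N) _; rewrite ler_pM2l//.
  have h1N : harmonic N <= 1 :> R by rewrite /= invf_le1 ?ler1n// ltr0Sn.
  rewrite (_ : hs N.+1 = hs N + harmonic N); last by rewrite /series /= big_nat_recr.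
  move: (hs N) (harmonic N) hN1 h1N => x y; lra.
move: hN; rewrite ler_pdivrMr// => hN.
rewrite (_ : _ * _ = 64 * K ^+ 2 / hs N); last by field; rewrite gt_eqF.
by rewrite ler_pdivrMr// (mulrC e).
Qed.

End Cutoff.

(** * Necessity of [D > 0] in a semi-inner product space *)

Section Necessity.
Variables (R : realType) (V : lmodType R) (B : V -> V -> R).
Hypothesis Bsym : forall u v, B u v = B v u.
Hypothesis Blin : forall k u v w, B (k *: u + v) w = k * B u w + B v w.
Hypothesis Bpos : forall u, 0 <= B u u.
Variables (a b c s : R) (e X : int -> int -> V).
Hypothesis s_gt0 : 0 < s.
Hypothesis e_white : forall i j k l,
  B (e i j) (e k l) = s * ((i, j) == (k, l))%:R.
Hypothesis X_stat : forall m n i j k l : int,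
  B (X (i + m) (j + n)) (X (k + m) (l + n)) = B (X i j) (X k l).
(** The equation is tested against every [w], since an almost sure equality is seen by [B] only in
    this form. *)
Hypothesis X_ar : forall i j w, B (X i j) w =
  a * B (X (i - 1) j) w + b * B (X i (j - 1)) w + c * B (X (i - 1) (j - 1)) w
  + B (e i j) w.

(** [psi / s] is a Green function: [G psi = s delta_0]. The minus signs make [psi] follow the
    recursion in the same direction as [X]. *)
Let psi k l := B (X 0 0) (e (- k) (- l)).

(** As seen by [B], [e] is [G X], so it inherits joint stationarity with [X]. *)
Let cross (m n i j k l : int) :
  B (X (i + m) (j + n)) (e (k + m) (l + n)) = B (X i j) (e k l).
Proof.
have eE k' l' w : B w (e k' l') = B w (X k' l') - a * B w (X (k' - 1) l')
    - b * B w (X k' (l' - 1)) - c * B w (X (k' - 1) (l' - 1)).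
  by rewrite !(Bsym w) X_ar; ring.
by rewrite !eE !(addrAC _ m) !(addrAC _ n) !X_stat.
Qed.

Let psi_ar k l : psi k l - a * psi (k - 1) l - b * psi k (l - 1)
  - c * psi (k - 1) (l - 1) = s * ((k == 0) && (l == 0))%:R.
Proof.
have psiE m n : psi (k - m) (l - n) = B (X (0 - m) (0 - n)) (e (- k) (- l)).
  by rewrite /psi -(cross (- m) (- n)); congr (B (X _ _) (e _ _)); lia.
have := psiE 1 0; rewrite !subr0 => ->; have := psiE 0 1; rewrite !subr0 => ->.
rewrite psiE /psi (X_ar 0 0) e_white xpair_eqE !(eq_sym 0 (- _)) !oppr_eq0.
by ring.
Qed.

Section Box.
Variables (N : nat) (t : int -> int -> R).
Local Notation pos p := ((p : nat)%:Z - N%:Z).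

Let Z := \sum_(p < (2 * N).+1) \sum_(q < (2 * N).+1)
  t (pos p) (pos q) *: e (- pos p) (- pos q).

Let B_Z w : B Z w =
  sym_sum N (fun k => sym_sum N (fun l => t k l * B (e (- k) (- l)) w)).
Proof.
rewrite /Z (sip_suml Blin); apply: eq_bigr => p _.
by rewrite (sip_suml Blin); apply: eq_bigr => q _; rewrite (sipZl Blin).
Qed.

Let B_ZZ : B Z Z = s * sym_sum N (fun k => sym_sum N (fun l => t k l ^+ 2)).
Proof.
rewrite B_Z -sym_sumZ; apply: eq_bigr => p _.
rewrite -sym_sumZ; apply: eq_bigr => q _.
rewrite Bsym B_Z /sym_sum (bigD1 p) //= (bigD1 q) //= e_white eqxx.
rewrite !big1 ?addr0 => [|p' pp'|q' qq'].
- by rewrite mulr1n; ring.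
- apply: big1 => q' _; rewrite e_white xpair_eqE (_ : (_ == _) = false) ?mulr0 //.
  by apply/negbTE; move: pp'; apply: contra => /eqP h; apply/eqP/val_inj => /=; lia.
- rewrite e_white xpair_eqE eqxx (_ : (_ == _) = false) ?mulr0 //.
  by apply/negbTE; move: qq'; apply: contra => /eqP h; apply/eqP/val_inj => /=; lia.
Qed.

(** Cauchy-Schwarz for [X 0 0] and [Z], the noise weighted by [t] on the reflected box; whiteness
    turns [B Z Z] into a sum of squares. *)
Lemma box_CauchySchwarz :
  sym_sum N (fun k => sym_sum N (fun l => t k l * psi k l)) ^+ 2 <=
  B (X 0 0) (X 0 0) * (s * sym_sum N (fun k => sym_sum N (fun l => t k l ^+ 2))).
Proof.
rewrite -B_ZZ; apply: le_trans (sip_CauchySchwarz Bsym Blin Bpos (X 0 0) Z).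
rewrite (Bsym _ Z) B_Z; apply: eqW; congr (_ ^+ 2).
by apply: eq_sym_sum => k; apply: eq_sym_sum => l; rewrite /psi Bsym.
Qed.

End Box.

Lemma sym_sum_delta N (f : int -> R) :
  sym_sum N (fun k => f k * (k == 0)%:R) = f 0.
Proof.
have N0 : (N < (2 * N).+1)%N by lia.
rewrite /sym_sum (bigD1 (Ordinal N0)) //= subrr eqxx mulr1 big1 ?addr0// => p pN.
rewrite (_ : (_ == _) = false) ?mulr0//; apply/negbTE; move: pN.
apply: contra => /eqP h; apply/eqP/val_inj => /=; lia.
Qed.

Lemma stationary_ar_D_gt0 :
  0 < (1 - a - b - c) * (1 - a + b + c) * (1 + a - b + c) * (1 + a + b - c).
Proof.
rewrite ltNge; apply/negP => /bounded_harmonic[h [h00 h1 hE]].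
have g0 : 0 <= B (X 0 0) (X 0 0) by [].
(* With [g = B (X 0 0) (X 0 0)], this tolerance makes the right-hand side at most
   [s^2 g / (g + 1) < s^2], while the left-hand side is [s^2]. *)
have e0 : 0 < s / (B (X 0 0) (X 0 0) + 1) by rewrite divr_gt0// ltr_wpDl.
have [N [v [v00 vN vle]]] := slowly_varying_truncation h00 h1 hE e0.
have := box_CauchySchwarz N (fun k l => v k l - a * v (k + 1) l - b * v k (l + 1)
      - c * v (k + 1) (l + 1)).
rewrite -(summation_by_parts psi a b c vN).
under eq_sym_sum do under eq_sym_sum do rewrite psi_ar.
have -> : sym_sum N (fun k => sym_sum N (fun l =>
    v k l * (s * ((k == 0) && (l == 0))%:R))) = s.
  transitivity (sym_sum N (fun k => (v k 0 * s) * (k == 0)%:R)).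
    apply: eq_sym_sum => k.
    rewrite -(sym_sum_delta N (fun l => v k l * s * (k == 0)%:R)).
    by apply: eq_sym_sum => l; rewrite -mulnb natrM; ring.
  by rewrite sym_sum_delta v00 mul1r.
apply/negP; rewrite -ltNge.
apply: (@le_lt_trans _ _
  (B (X 0 0) (X 0 0) * (s * (s / (B (X 0 0) (X 0 0) + 1))))).
  by rewrite ler_wpM2l// ler_pM2l.
move: (B (X 0 0) (X 0 0)) g0 => g g0.
have g1 : 0 < g + 1 by lra.
rewrite (_ : g * _ = s ^+ 2 * (g / (g + 1))); last by field; rewrite gt_eqF.
by rewrite gtr_pMr ?exprn_gt0// ltr_pdivrMr// mul1r ltrDl.
Qed.

End Necessity.

(** * Limits in L^2 *)

Section GeometricSteps.
Local Open Scope classical_set_scope.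
Variables (R : realType) (u : R^nat) (t M : R).
Hypotheses (t_gt0 : 0 < t) (t_lt1 : t < 1) (M_ge0 : 0 <= M).
Hypothesis step : forall n, (t ^+ 2) ^- n * (u n.+1 - u n) ^+ 2 <= M.

Let step_abs n : `|u n.+1 - u n| <= Num.sqrt M * t ^+ n.
Proof.
have tn : 0 < t ^+ n by rewrite exprn_gt0.
rewrite -(@ler_pXn2r _ 2) ?nnegrE// ?mulr_ge0 ?sqrtr_ge0 ?(ltW tn)//.
rewrite exprMn sqr_sqrtr// real_normK ?num_real//.
by move: (step n); rewrite -exprM mulnC exprM mulrC ler_pdivrMr// exprn_gt0.
Qed.

Lemma geometric_steps_cvg : cvgn u.
Proof.
have h : cvgn (series (telescope u)).
  apply: normed_cvg; apply: (@series_le_cvg _ _ (geometric (Num.sqrt M) t)).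
  - by move=> n /=; exact: normr_ge0.
  - by move=> n /=; rewrite mulr_ge0 ?sqrtr_ge0 ?exprn_ge0// ltW.
  - by move=> n /=; exact: step_abs.
  - by apply: is_cvg_geometric_series; rewrite ger0_norm// ltW.
rewrite (_ : u = fun n => u 0%N + series (telescope u) n); last first.
  by apply/funext => n; exact: eq_sum_telescope.
by apply: is_cvgD => //; exact: is_cvg_cst.
Qed.

(** Telescoping bounds [|u n - u 0|] by a geometric sum. The bound is uniform in [n], so it can
    serve as an envelope for dominated convergence. *)
Lemma geometric_steps_le n : u n ^+ 2 <= 2 * u 0%N ^+ 2 + 2 / (1 - t) ^+ 2 * M.
Proof.
have t1 : 0 < 1 - t by rewrite subr_gt0.
have h : `|u n - u 0%N| * (1 - t) <= Num.sqrt M * (1 - t ^+ n).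
  elim: n => [|n IH]; first by rewrite subrr normr0 mul0r expr0 subrr mulr0.
  rewrite -(subrK (u n) (u n.+1)) -addrA.
  apply: (@le_trans _ _ ((`|u n.+1 - u n| + `|u n - u 0%N|) * (1 - t))).
    by rewrite ler_pM2r// ler_normD.
  rewrite mulrDl exprS.
  have : `|u n.+1 - u n| * (1 - t) <= Num.sqrt M * t ^+ n * (1 - t).
    by rewrite ler_pM2r.
  lra.
have h2 : (u n - u 0%N) ^+ 2 <= M / (1 - t) ^+ 2.
  rewrite ler_pdivlMr ?exprn_gt0// -exprMn -(sqr_sqrtr M_ge0) -real_normK ?num_real//.
  rewrite lerXn2r ?nnegrE ?sqrtr_ge0// normrM (ger0_norm (ltW t1)).
  apply: le_trans h _; rewrite ler_piMr ?sqrtr_ge0// gerBl exprn_ge0 ?ltW//.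
(* [2 u_0^2 + 2 (u_n - u_0)^2 - u_n^2 = (u_n - 2 u_0)^2]. *)
rewrite -mulrA (mulrC _ M); have := sqr_ge0 (u n - 2 * u 0%N); nra.
Qed.

End GeometricSteps.

Section L2.
Local Open Scope classical_set_scope.
Context (d : measure_display) (T : measurableType d) (R : realType)
  (P : probability T R).
Notation L2 := (LfunType P (lee1n 2)).

Lemma L2_mem (u : L2) : (u : T -> R) \in Lfun P 2%:E.
Proof. exact: LfunP. Qed.

Lemma L2_mul_integrable (u v : L2) :
  P.-integrable setT (EFin \o (fun x => u x * v x)).
Proof. exact/Lfun1_integrable/(Lfun2_mul_Lfun1 (L2_mem u) (L2_mem v)). Qed.

Lemma L2_measurable (u : L2) : measurable_fun setT u.
Proof. by []. Qed.

(** Elements of [L2] are functions, not classes modulo null sets, so this form is only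
    semidefinite. *)
Definition ip (u v : L2) : R := \int[P]_x (u x * v x).

Lemma ipC u v : ip u v = ip v u.
Proof. by apply: eq_Rintegral => x _; rewrite mulrC. Qed.

Lemma ip_lin k u v w : ip (k *: u + v) w = k * ip u w + ip v w.
Proof.
rewrite /ip -RintegralZl//; last exact: L2_mul_integrable.
rewrite -RintegralD//; last 2 first.
- have := integrableZl measurableT k (L2_mul_integrable u w).
  by apply: eq_integrable.
- exact: L2_mul_integrable.
by apply: eq_Rintegral => x _; rewrite mulrDl mulrA.
Qed.

Lemma ip_ge0 u : 0 <= ip u u.
Proof. by apply: Rintegral_ge0 => x _; rewrite -expr2 sqr_ge0. Qed.

(** Necessity works with [cov] because a given stationary solution is not assumed centred; existence
    works with [ip], which passes to limits by dominated convergence. *)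
Definition cov (u v : L2) : R := fine (covariance P u v).

Lemma covC u v : cov u v = cov v u.
Proof. by rewrite /cov covarianceC. Qed.

Lemma L1_mem (u : L2) : (u : T -> R) \in Lfun P 1.
Proof. by apply: Lfun_subset12 (L2_mem u); exact: fin_num_measure. Qed.

Lemma covariance_fin (u v : L2) : covariance P u v \is a fin_num.
Proof.
apply: covariance_fin_num; [exact: L1_mem..|].
exact: Lfun2_mul_Lfun1 (L2_mem u) (L2_mem v).
Qed.

Lemma cov_lin k u v w : cov (k *: u + v) w = k * cov u w + cov v w.
Proof.
rewrite /cov.
have -> : (k *: u + v : L2) = ((k *: u : L2) : T -> R) \+ v :> (T -> R) by [].
rewrite covarianceDl ?L2_mem//.
have -> : (k *: u : L2) = k \o* (u : T -> R) :> (T -> R).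
  by apply/funext => x /=; rewrite mulrC.
rewrite covarianceZl ?L1_mem//;
  last exact: Lfun2_mul_Lfun1 (L2_mem u) (L2_mem w).
by rewrite fineD ?fin_numM ?covariance_fin// fineM ?covariance_fin.
Qed.

Lemma cov_ge0 u : 0 <= cov u u.
Proof. by rewrite fine_ge0//; exact: variance_ge0. Qed.

(** One integrable envelope controls all the squares. Since [2 |u w| <= u^2 + w^2], dominated
    convergence then applies to products of two such sequences. *)
Definition dominated_limit (U : nat -> L2) (F : T -> R) : Prop :=
  [/\ measurable_fun setT F, {ae P, forall x, U n x @[n --> \oo] --> F x} &
    exists2 H : T -> \bar R, P.-integrable setT H &
      {ae P, forall x, forall n, ((U n x ^+ 2)%:E <= H x)%E}].

Lemma dominated_limit_cst (u : L2) : dominated_limit (fun=> u) u.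
Proof.
split; first exact: L2_measurable.
  by apply/aeW => x; exact: cvg_cst.
exists (EFin \o (fun x => u x * u x)); first exact: L2_mul_integrable.
by apply/aeW => x n; rewrite /= expr2.
Qed.

Lemma dominated_limit_mul (U W : nat -> L2) F G :
  dominated_limit U F -> dominated_limit W G ->
  P.-integrable setT (EFin \o (fun x => F x * G x)) /\
  ip (U n) (W n) @[n --> \oo] --> \int[P]_x (F x * G x).
Proof.
move=> [mF cF [H iH hH]] [mG cG [K iK hK]].
have [iFG _ cvFG] := @dominated_convergence _ T R P setT measurableT
  (fun n x => (U n x * W n x)%:E) (fun x => (F x * G x)%:E) (fun x => H x + K x)%E
  (fun n => measurable_int P (L2_mul_integrable (U n) (W n)))
  ltac:(by apply/measurable_EFinP; exact: measurable_funM)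
  ltac:(by apply: filterS2 cF cG => x c1 c2 _; apply: cvg_EFin;
    [exact: nearW | exact: cvgM])
  (integrableD measurableT iH iK)
  ltac:(apply: filterS2 hH hK => x h1 h2 n _;
    apply: (@le_trans _ _ ((U n x ^+ 2)%:E + (W n x ^+ 2)%:E)%E);
    [rewrite -EFinD lee_fin ler_norml; apply/andP; split; nra | exact: leeD]).
split => //.
rewrite /ip /Rintegral; apply: fine_cvg; rewrite fineK; last exact: integrable_fin_num.
exact: cvFG.
Qed.

Lemma L2_of_sqr_integrable (F : T -> R) : measurable_fun setT F ->
  P.-integrable setT (EFin \o (fun x => F x * F x)) -> F \in Lfun P 2%:E.
Proof.
move=> mF /integrableP[_ iF]; rewrite inE; apply/andP; split; rewrite inE//=.
rewrite /finite_norm unlock /Lnorm; apply: poweR_lty.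
apply: le_lt_trans iF; apply: eqW.
apply: eq_integral => x _ /=; congr EFin.
by rewrite powR_mulrn// normrM expr2.
Qed.

(** A weighted sum of squared increments has finite mean, hence is finite almost surely; where it is
    finite, the increments decay geometrically and the sequence converges under an explicit
    envelope. *)
Lemma dominated_limit_ex (U : nat -> L2) (C q : R) : 0 <= q < 1 ->
  (forall n, ip (U n.+1 - U n) (U n.+1 - U n) <= C * q ^+ n) ->
  exists F, dominated_limit U F.
Proof.
move=> /andP[q0 q1] hU.
(* Bernoulli: [t ^+ 4 >= 1 - 4 (1 - t) = q].  Weighting the increments by
   [t ^- (2 n)] makes a single integrable function [W] control all of them. *)
pose t := 1 - (1 - q) / 4.
have t0 : 0 < t by rewrite /t; lra.
have t1 : t < 1 by rewrite /t; lra.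
have qt : q <= t ^+ 2 * t ^+ 2.
  have h1 : (1 + q) / 2 <= t ^+ 2 by have := sqr_ge0 (1 - q); rewrite /t; nra.
  apply: (@le_trans _ _ ((1 + q) / 2 * ((1 + q) / 2))).
    by have := sqr_ge0 (1 - q); nra.
  by rewrite ler_pM// divr_ge0// addr_ge0.
pose D n x := U n.+1 x - U n x.
pose w n x : \bar R := ((t ^+ 2) ^- n * D n x ^+ 2)%:E.
have mD n : measurable_fun setT (D n) by apply: measurable_funB; exact: L2_measurable.
have mw n : measurable_fun setT (w n).
  by apply/measurable_EFinP/measurable_funM => //; exact: measurable_funX.
have w0 n x : (0 <= w n x)%E.
  by rewrite lee_fin mulr_ge0 ?sqr_ge0// invr_ge0 !exprn_ge0// ltW.
pose W x := (\sum_(n <oo) w n x)%E.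
have C0 : 0 <= C.
  by have := hU 0%N; rewrite expr0 mulr1; apply: le_trans; exact: ip_ge0.
(* [q <= t^4] gives [t^(-2n) q^n <= t^(2n)], which is summable. *)
have iw n : (\int[P]_x w n x <= (C * (t ^+ 2) ^+ n)%:E)%E.
  have e1 : (\int[P]_x w n x =
      ((t ^+ 2) ^- n * ip (U n.+1 - U n) (U n.+1 - U n))%:E)%E.
    have iD := L2_mul_integrable (U n.+1 - U n) (U n.+1 - U n).
    by rewrite EFinM /ip fineK ?integrable_fin_num// -integralZl//.
  rewrite e1 lee_fin ler_pdivrMl ?exprn_gt0// mulrCA -exprMn.
  by apply: le_trans (hU n) _;
    rewrite ler_wpM2l// lerXn2r ?nnegrE ?mulr_ge0 ?exprn_ge0 ?(ltW t0).
have iW : P.-integrable setT W.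
  apply/integrableP; split.
    by apply: ge0_emeasurable_sum.
  under eq_integral do rewrite gee0_abs ?nneseries_ge0//.
  rewrite integral_nneseries//.
  have z1 : `|t ^+ 2| < 1 by rewrite ger0_norm ?sqr_ge0// expr_lt1// ltW.
  apply: (@le_lt_trans _ _ (\sum_(n <oo) (C * (t ^+ 2) ^+ n)%:E)%E).
    by apply: lee_nneseries => [k _ _|k _];[|exact: iw k]; exact: integral_ge0.
  rewrite (_ : limn _ = (C / (1 - t ^+ 2))%:E) ?ltry//.
  apply: cvg_lim => //; under eq_fun do rewrite sumEFin.
  apply: cvg_EFin; first exact: nearW.
  exact: cvg_geometric_series.
pose H (x : T) := ((2 * U 0%N x ^+ 2)%:E + (2 / (1 - t) ^+ 2)%:E * W x)%E.
have iH : P.-integrable setT H.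
  apply: integrableD => //; last exact: integrableZl.
  have := integrableZl measurableT 2 (L2_mul_integrable (U 0%N) (U 0%N)).
  by apply: eq_integrable => // x _; rewrite /= -EFinM expr2.
have good : {ae P, forall x, cvgn (fun n => U n x) /\
    forall n, ((U n x ^+ 2)%:E <= H x)%E}.
  have := integrable_ae measurableT iW; apply: filterS => x /(_ I) Wfin.
  have W0 : (0 <= W x)%E by apply: nneseries_ge0.
  have hs n : (t ^+ 2) ^- n * (U n.+1 x - U n x) ^+ 2 <= fine (W x).
    rewrite -lee_fin fineK//; apply: le_trans (nneseries_lim_ge n.+1 _) => //.
    by rewrite big_nat_recr//= leeDr// sume_ge0.
  have M0 : 0 <= fine (W x) by rewrite fine_ge0.
  split; first exact: (geometric_steps_cvg t0 t1 M0 hs).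
  move=> n; rewrite /H -(fineK Wfin) -EFinM -EFinD lee_fin.
  exact: (geometric_steps_le t0 t1 M0 hs).
(* The upper limit is measurable on the whole space and equals the limit wherever the sequence
   converges. *)
exists (fun x => fine (limn_esup (fun n => (U n x)%:E))); split.
- apply: measurableT_comp; first exact: fine_measurable.
  apply: measurable_fun_limn_esup => k; apply/measurable_EFinP; exact: L2_measurable.
- apply: filterS good => x [c _].
  have -> : limn_esup (fun n => (U n x)%:E) = (limn (fun n => U n x))%:E.
    apply: (cvg_limn_einf_sup _).2; apply: cvg_EFin; [exact: nearW | exact: c].
  exact: c.
- by exists H => //; apply: filterS good => x [].
Qed.

End L2.

(** * The two implications for random fields *)

Section Main.
Local Open Scope classical_set_scope.
Context (d : measure_display) (T : measurableType d) (R : realType)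
  (P : probability T R).
Notation L2 := (LfunType P (lee1n 2)).

Lemma cov_ae_eq (u v w : L2) : {ae P, forall x, u x = v x} -> cov u w = cov v w.
Proof.
move=> uv; rewrite /cov; congr fine; rewrite covariance.unlock expectation.unlock.
have -> : (\int[P]_x (u x)%:E = \int[P]_x (v x)%:E)%E.
  apply: ae_eq_integral => //; try by apply/measurable_EFinP; exact: L2_measurable.
  by apply: filterS uv => x -> _.
apply: ae_eq_integral => //.
- apply/measurable_EFinP/measurable_funM; apply: measurable_funB => //;
  exact: L2_measurable.
- apply/measurable_EFinP/measurable_funM; apply: measurable_funB => //;
  exact: L2_measurable.
- by apply: filterS uv => x uvx _ /=; rewrite !fctE /= uvx.
Qed.

Lemma cov_ip (u v : L2) : ('E_P[u] = 0)%E -> cov u v = ip u v.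
Proof.
move=> u0; rewrite /cov covarianceE ?L1_mem//;
  last exact: Lfun2_mul_Lfun1 (L2_mem u) (L2_mem v).
by rewrite u0 mul0e sube0 expectation.unlock.
Qed.

Variables (sigma a b c : R) (eps : int -> int -> {RV P >-> R}).
Hypothesis heps : white_noise P sigma eps.

Definition L2_field (X : int -> int -> {RV P >-> R})
    (hX : forall i j, (X i j : T -> R) \in Lfun P 2%:E) (i j : int) : L2 :=
  Lfun_Sub (lee1n 2) (hX i j).

Let eps_L2 i j : (eps i j : T -> R) \in Lfun P 2%:E.
Proof. by case: heps. Qed.

Let e := L2_field eps_L2.

Let e_white i j k l : cov (e i j) (e k l) = sigma ^+ 2 * ((i, j) == (k, l))%:R.
Proof.
case: heps => _ _ vare cove.
have [[<- <-]|ne] := eqVneq (i, j) (k, l).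
  by rewrite mulr1; have := vare i j; rewrite /variance /cov => ->.
by rewrite mulr0; have := cove _ _ _ _ ne; rewrite /cov => ->.
Qed.

Lemma stationary_ar_det (X : int -> int -> {RV P >-> R}) : 0 < sigma ^+ 2 ->
  wide_sense_stationary P X -> ar_equation P a b c eps X ->
  0 < (1 - a - b - c) * (1 - a + b + c) * (1 + a - b + c) * (1 + a + b - c).
Proof.
move=> s0 [X2 _ Xcov] Xar; pose x := L2_field X2.
apply: (stationary_ar_D_gt0 (@covC _ _ _ P) (@cov_lin _ _ _ P) (@cov_ge0 _ _ _ P)
  (X := x) s0 e_white) => [m n i j k l|i j w].
  rewrite /cov; congr fine; have := Xcov (i - k) (j - l) (i + m) (j + n) i j.
  rewrite (_ : i + m - (i - k) = k + m); last by lia.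
  rewrite (_ : j + n - (j - l) = l + n); last by lia.
  by rewrite !subKr.
rewrite -!(sipZl (@cov_lin _ _ _ P)) -!(sipDl (@cov_lin _ _ _ P)).
by apply: cov_ae_eq; exact: Xar.
Qed.

Let e_ip i j k l : ip (e i j) (e k l) = cov (e i j) (e k l).
Proof. by rewrite cov_ip//; case: heps => _ + _ _; apply. Qed.

Let e_stat m n i j k l :
  ip (e (i + m) (j + n)) (e (k + m) (l + n)) = ip (e i j) (e k l).
Proof. by rewrite !e_ip !e_white !xpair_eqE !(inj_eq (addIr _)). Qed.

Let kappa := 4 * (1 + a ^+ 2 + b ^+ 2 + c ^+ 2).
Let mu := `|1 + a ^+ 2 - b ^+ 2 - c ^+ 2| - 2 * `|a + b * c|.

(** The mean is the inner product with this constant, so zero mean passes through filters and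
    dominated limits. *)
Let one : L2 := Lfun_Sub (lee1n 2) (Lfun_cst P 1 2).

Let oneE w : one w = 1. Proof. by []. Qed.

Let filter_mean0 F : filter_of e F -> forall i j, ip (F i j) one = 0.
Proof.
elim=> [i j|k F1 F2 _ IH1 _ IH2 i j|m n F1 _ IH i j]; last exact: IH.
  case: heps => _ /(_ i j) m0 _ _; rewrite /ip.
  have -> : 0 = fine ('E_P[eps i j])%E by rewrite m0.
  rewrite expectation.unlock; congr fine.
  by apply: eq_integral => x _; rewrite oneE mulr1.
by rewrite (ip_lin k) IH1 IH2 mulr0 addr0.
Qed.

Lemma ip_subr_le (u v : L2) : ip (u - v) (u - v) <= 2 * ip u u + 2 * ip v v.
Proof.
have sipE := (sipDl (@ip_lin _ _ _ P), sipDr (@ipC _ _ _ P) (@ip_lin _ _ _ P),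
  sipNl (@ip_lin _ _ _ P), sipNr (@ipC _ _ _ P) (@ip_lin _ _ _ P)).
by have := ip_ge0 (u + v); rewrite !sipE; lra.
Qed.

Lemma stationary_ar_exists :
  0 < (1 - a - b - c) * (1 - a + b + c) * (1 + a - b + c) * (1 + a + b - c) ->
  exists X : int -> int -> {RV P >-> R},
    wide_sense_stationary P X /\ ar_equation P a b c eps X.
Proof.
move=> hD.
have mu0 : 0 < mu.
  rewrite /mu subr_gt0 -[2]ger0_norm// -normrM.
  rewrite -(@ltr_pXn2r _ 2) ?nnegrE// !real_normK ?num_real// -subr_gt0.
  by apply: lt_le_trans hD _; apply: eqW; ring.
have ipS := @ipC _ _ _ P; have ipL := @ip_lin _ _ _ P; have ip0 := @ip_ge0 _ _ _ P.
pose q := 1 - mu ^+ 2 / kappa ^+ 2.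
have q01 : 0 <= q < 1 by exact: decay_rate.
pose Y n := ar_descent a b c kappa^-1 e n.
pose r n := ar_residual a b c kappa^-1 e n.
have fY n : filter_of e (Y n) by exact: filter_ar_descent.
have limY i j : exists F, dominated_limit (fun n => Y n i j) F.
  apply: (dominated_limit_ex (C := kappa^-1 * ip (e i j) (e i j)) q01) => n.
  exact: (ar_descent_step_le ipS ipL ip0 e_stat).
have r_le n i j : ip (r n i j) (r n i j) <= ip (e i j) (e i j) * q ^+ n.
  by rewrite mulrC; exact: (ar_residual_le ipS ipL ip0 e_stat).
(* This upgrades the [L^2] decay of the residuals to almost sure convergence along the whole
   sequence; 4 comes from [ip_subr_le] applied to consecutive residuals. *)
have limr i j : exists F, dominated_limit (fun n => r n i j) F.
  apply: (dominated_limit_ex (C := 4 * ip (e i j) (e i j)) q01) => n.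
  apply: le_trans (ip_subr_le _ _) _.
  have h1 := r_le n i j; have h2 := r_le n.+1 i j.
  have h3 : ip (e i j) (e i j) * q ^+ n.+1 <= ip (e i j) (e i j) * q ^+ n.
    by case/andP: q01 => q0 q1; rewrite ler_wpM2l// exprS ler_piMl ?exprn_ge0 ?(ltW q1).
  move: h1 h2 h3; rewrite -mulrA; lra.
(* The almost sure limit has second moment [lim |r_n|^2 = 0], hence vanishes almost surely. *)
have r_cvg0 i j : {ae P, forall x, r n i j x @[n --> \oo] --> 0}.
  have [F hF] := limr i j; have [iF cF] := dominated_limit_mul hF hF.
  have [mF cvF _] := hF.
  have F0 : \int[P]_x (F x * F x) = 0.
    apply: (cvg_unique (@Rhausdorff R) cF) => /=.
    apply: (squeeze_cvgr (f := fun=> 0) (h := geometric (ip (e i j) (e i j)) q)).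
    - by apply: nearW => n; rewrite ip_ge0 r_le.
    - exact: cvg_cst.
    - by apply: cvg_geometric; case/andP: q01 => q0 q1; rewrite ger0_norm.
  have : ae_eq P setT (fun x => (F x * F x)%:E) (cst 0%E).
    apply/ae_eq_integral_abs => //; first by apply/measurable_EFinP/measurable_funM.
    under eq_integral do rewrite gee0_abs ?lee_fin -?expr2 ?sqr_ge0// expr2.
    by rewrite -(fineK (integrable_fin_num measurableT iF)) -/(Rintegral _ _ _) F0.
  apply: filterS2 cvF => x cx /(_ I) FF0.
  have Fx : F x = 0.
    by apply/eqP; rewrite -[_ == _]orbb -mulf_eq0; apply/eqP/EFin_inj.
  by rewrite Fx in cx.
pose F i j := projT1 (cid (limY i j)).
have hF i j : dominated_limit (fun n => Y n i j) (F i j) := projT2 (cid (limY i j)).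
have F2 i j : F i j \in Lfun P 2%:E.
  have [mF _ _] := hF i j; have [iF _] := dominated_limit_mul (hF i j) (hF i j).
  exact: L2_of_sqr_integrable.
pose x i j : L2 := Lfun_Sub (lee1n 2) (F2 i j).
have x_mean i j : ('E_P[x i j] = 0)%E.
  have [iF cF] := dominated_limit_mul (hF i j) (dominated_limit_cst one).
  rewrite expectation.unlock.
  have -> : (\int[P]_w (x i j w)%:E = \int[P]_w (F i j w * one w)%:E)%E.
    by apply: eq_integral => w _; rewrite oneE mulr1.
  rewrite -(fineK (integrable_fin_num measurableT iF)); congr EFin.
  apply: (cvg_unique (@Rhausdorff R) cF).
  rewrite /= (_ : (fun n => _) = fun=> 0); first exact: cvg_cst.
  by apply/funext => n; exact: filter_mean0.
have x_ip i j k l : ip (Y n i j) (Y n k l) @[n --> \oo] --> ip (x i j) (x k l).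
  by have [] := dominated_limit_mul (hF i j) (hF k l).
have x_cov i j k l : covariance P (x i j) (x k l) = (ip (x i j) (x k l))%:E.
  by rewrite -cov_ip// /cov fineK// covariance_fin.
exists (fun i j => x i j : {RV P >-> R}); split; first split.
- by move=> i j; exact: F2.
- by move=> i j i' j'; rewrite !x_mean.
(* The means vanish, so covariances are inner products, which are limits of those of [Y n]; the
   latter depend only on the lag. *)
- move=> h1 h2 i j i' j'; rewrite !x_cov; congr EFin.
  apply: (cvg_unique (@Rhausdorff R) (x_ip _ _ _ _)).
  have shift : (fun n => ip (Y n i' j') (Y n (i' - h1) (j' - h2))) =
      (fun n => ip (Y n i j) (Y n (i - h1) (j - h2))).
    by apply/funext => n; apply: (filter_statP ipS ipL e_stat) => //; lia.
  by have := x_ip i' j' (i' - h1) (j' - h2); rewrite shift.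
move=> i j.
have cY k l : {ae P, forall w, Y n k l w @[n --> \oo] --> F k l w} by case: (hF k l).
(* Where the four neighbouring iterates converge and the residual tends to 0, the identity
   [r_n = eps - G Y_n] passes to the limit. *)
apply: filterS2 (filterI (filterI (cY i j) (cY (i - 1) j))
  (filterI (cY i (j - 1)) (cY (i - 1) (j - 1)))) (r_cvg0 i j) =>
  w [[c1 c2] [c3 c4]] cr.
have : r n i j w @[n --> \oo] --> eps i j w - (F i j w - a * F (i - 1) j w
    - b * F i (j - 1) w - c * F (i - 1) (j - 1) w).
  apply: cvgB; first exact: cvg_cst.
  by apply: cvgB; [apply: cvgB; [apply: cvgB|]|] => //; exact: cvgZr.
move=> /(cvg_unique (@Rhausdorff R) cr) h.
rewrite /x /=; lra.
Qed.

End Main.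

Theorem proposition2 (d : measure_display) (T : measurableType d)
    (R : realType) (P : probability T R) (sigma a b c : R)
    (eps : int -> int -> {RV P >-> R})
    (sigma2_gt0 : 0 < sigma ^+ 2) (heps : white_noise P sigma eps) :
  (exists X : int -> int -> {RV P >-> R},
      wide_sense_stationary P X /\ ar_equation P a b c eps X) <->
  0 < (1 - a - b - c) * (1 - a + b + c) * (1 + a - b + c) * (1 + a + b - c).
Proof.
split => [[X [Xwss Xar]]|]; first exact: stationary_ar_det heps _ _ Xwss Xar.
exact: stationary_ar_exists heps.
Qed.
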